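(* Let $t\ge 1$ and $k\ge 2t$ be integers, and let $f:\mathbb F_{2^n}\to\mathbb Z_{2^k}$ be a g-hyperbent function given as $$f(x)=a_1(x)+2a_2(x)+\cdots+2^{k-1}a_k(x)=g(x)+2^th(x)$$ for some Boolean functions $a_i:\mathbb F_{2^n}\to\mathbb F_2$, $1\le i\le k$, where $$g(x)=a_1(x)+2a_2(x)+\cdots+2^{t-1}a_t(x)\in\mathcal{GB}_n^{2^t},$$ $$h(x)=a_{t+1}(x)+2a_{t+2}(x)+\cdots+2^{k-t-1}a_k(x)\in\mathcal{GB}_n^{2^{k-t}}.$$ If $n$ is even or $k\ge 3$, then the functions $h(x)$ and $h(x)+2^{k-2t}g(x)$ are g-hyperbent functions in $\mathcal{GB}_n^{2^{k-t}}$.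
   Context: $\mathcal{GB}_n^{q}$ denotes the set of functions from $\mathbb F_{2^n}$ to $\mathbb Z_q$ (generalized Boolean functions). Values of Boolean functions are read as the integers $0,1$ when multiplied by powers of $2$ and added, so $g$ and $h$ have integer representatives in $\{0,\ldots,2^t-1\}$ and $\{0,\ldots,2^{k-t}-1\}$ respectively; $h+2^{k-2t}g$ is computed modulo $2^{k-t}$. Let $\zeta_{2^r}=e^{2\pi i/2^r}$ and let $\mathrm{Tr}_n:\mathbb F_{2^n}\to\mathbb F_2$ be the absolute trace. A function $F:\mathbb F_{2^n}\to\mathbb Z_{2^r}$ is called g-hyperbent (generalized hyperbent) if $$\left|\sum_{x\in\mathbb F_{2^n}}\zeta_{2^r}^{F(x)}(-1)^{\mathrm{Tr}_n(ux^i)}\right|=2^{n/2}$$ for all $u\in\mathbb F_{2^n}$ and all integers $i\ge1$ with $\gcd(i,2^n-1)=1$. *)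

(* Defs.v *)
From mathcomp Require Import all_boot all_order all_algebra.
From mathcomp Require Import complex.
From mathcomp Require Import reals exp trigo.

Set Implicit Arguments.
Unset Strict Implicit.
Unset Printing Implicit Defensive.

Import GRing.Theory Num.Theory.

Local Open Scope ring_scope.
Local Open Scope complex_scope.

(* The field F_{2^n} is a finite field L with #|L| = 2 ^ n. *)

(* The sum of the conjugates of x is fixed by the Frobenius map, so it is the
   element 0 or 1 of L; abs_trace returns the corresponding element of F_2. *)
Definition abs_trace (n : nat) (L : finFieldType) (x : L) : 'F_2 :=
  if \sum_(j < n) x ^+ (2 ^ j) == 0 then 0 else 1.

(* e^(2 pi i / 2^r) *)
Definition zeta (R : realType) (r : nat) : R[i] :=
  cos (2 * pi / 2 ^+ r) +i* sin (2 * pi / 2 ^+ r).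

(* The exponents are the representatives of F x in {0, ..., 2^r - 1} and of
   the trace in {0, 1}. To be used with 0 < r only, as 'Z_(2 ^ 0) is Z/2. *)
Definition g_hyperbent (R : realType) (n r : nat) (L : finFieldType)
    (F : L -> 'Z_(2 ^ r)) : Prop :=
  forall (u : L) (i : nat), (1 <= i)%N -> coprime i (2 ^ n - 1) ->
    `| \sum_(x : L) zeta R r ^+ (F x : nat)
         * (-1) ^+ (abs_trace n (u * x ^+ i) : nat) |
      = ((2 : R) `^ (n%:R / 2))%:C.

Arguments g_hyperbent R n r {L} F.

(* Main.v *)
(* Let z = e^(2 pi i / 2^k), N = 2^(k-1) and T = 2^t. A sum S = sum_x z^f(x) (+-1)
   lies in Z[z] and satisfies |S|^2 = 2^n. As 2 is associated to (1 - z)^N and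
   the residue field of 1 - z is F_2, the powers of 1 - z can be removed from
   S and its conjugate simultaneously, so S = (1 - i)^n c with c in Z[z] and
   |c| = 1. Comparing constant coefficients in c c^* = 1 shows that the
   squares of the integer coefficients of c add up to 1, so c = +- z^j.
   When n is even or i belongs to Z[z^T], this gives S = w z^j with w in
   Z[z^T]. Now S = sum_b z^b S_b, where S_b in Z[z^T] collects the x with
   g(x) = b; since 1, z, ..., z^(T-1) are independent over Z[z^T], all but one
   of the S_b vanish. Hence sum_b y^b S_b has the same modulus for every y on
   the unit circle; y = 1 gives h and y = z^(2^(k-t)) gives h + 2^(k-2t) g. *)
From HB Require Import structures.
Require Import Defs.
From mathcomp Require Import all_boot all_order all_algebra.
From mathcomp Require Import complex.
From mathcomp Require Import reals exp trigo.
From mathcomp Require Import ring zify.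

Local Open Scope ring_scope.

Set Implicit Arguments.
Unset Strict Implicit.
Unset Printing Implicit Defensive.

Import Order.TTheory GRing.Theory Num.Theory.

(** * The ring Z[z], as values of integer polynomials at [z] *)

(** Frobenius modulo 2, with an explicit remainder so that the coefficients can be read off for
    Eisenstein's criterion. *)
Lemma exprD1_pow2 (m : nat) :
  exists r : {poly int}, ('X + 1) ^+ (2 ^ m) = 'X^(2 ^ m) + 1 + r *+ 2.
Proof.
elim: m => [|m [r IH]]; first by exists 0; rewrite !expr1 mul0rn addr0.
rewrite !expnSr !exprM IH.
exists ('X^(2 ^ m) + ('X^(2 ^ m) + 1) * r *+ 2 + r ^+ 2 *+ 2).
by ring.
Qed.

Definition zeval (C : numClosedFieldType) (z : C) (p : {poly int}) : C :=
  (map_poly intr p).[z].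

Lemma zeval_is_zmod_morphism (C : numClosedFieldType) (z : C) :
  zmod_morphism (zeval z).
Proof. by move=> p q; rewrite /zeval rmorphB hornerD hornerN. Qed.

Lemma zeval_is_monoid_morphism (C : numClosedFieldType) (z : C) :
  monoid_morphism (zeval z).
Proof.
by split=> [|p q]; rewrite /zeval ?rmorph1 ?hornerC // rmorphM hornerM.
Qed.

HB.instance Definition _ (C : numClosedFieldType) (z : C) :=
  GRing.isZmodMorphism.Build _ _ (zeval z) (zeval_is_zmod_morphism z).
HB.instance Definition _ (C : numClosedFieldType) (z : C) :=
  GRing.isMonoidMorphism.Build _ _ (zeval z) (zeval_is_monoid_morphism z).

Lemma zevalX (C : numClosedFieldType) (z : C) : zeval z 'X = z.
Proof. by rewrite /zeval map_polyX hornerX. Qed.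

Lemma zevalXn (C : numClosedFieldType) (z : C) i : zeval z 'X^i = z ^+ i.
Proof. by rewrite rmorphXn /= zevalX. Qed.

Section Pow2.

Variables (C : numClosedFieldType) (m : nat) (z : C).
Let N := (2 ^ m)%N.
Hypothesis zN : z ^+ N = -1.

Lemma size_XD1_pow2 : size (('X + 1) ^+ N + 1 : {poly int}) = N.+1.
Proof.
have sX : size (('X + 1 : {poly int}) ^+ N) = N.+1.
  by rewrite -[1]/(1%:P) -[1]opprK polyCN size_exp_XsubC.
by rewrite size_polyDl // sX size_poly1 ltnS expn_gt0.
Qed.

(* Eisenstein's criterion at 2. *)
Lemma irreducible_XD1_pow2 :
  irreducible_poly (('X + 1) ^+ N + 1 : {poly int}).
Proof.
have [r Er] := exprD1_pow2 m.
have s := size_XD1_pow2.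
have c i : (('X + 1 : {poly int}) ^+ N + 1)`_i = (i == N)%:R + 2 * (1 + r)`_i.
  have -> : ('X + 1) ^+ N + 1 = 'X^N + (1 + r) *+ 2 by rewrite Er; ring.
  by rewrite coefD coefXn coefMn mulr_natl.
apply: (@eisenstein_crit 2 (('X + 1) ^+ N + 1)) => //.
- by rewrite s eqSS -lt0n expn_gt0.
- by rewrite lead_coefE s c eqxx; lia.
(* The constant coefficient is the value at 0, which is 2, hence not divisible by 4. *)
- by rewrite -horner_coef0 !hornerE expr1n.
- by rewrite s /= => i iN; rewrite c ltn_eqF // add0r dvdz_mulr.
Qed.

(** After the shift X -> X + 1, the polynomial X^N + 1 becomes the irreducible [Q], which vanishes
    at z - 1. If [Q] divides the shifted [p], degrees force p = 0; otherwise the two are coprime yet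
    share the root z - 1. *)
Lemma zeval_eq0 (p : {poly int}) : (size p <= N)%N -> zeval z p = 0 -> p = 0.
Proof.
move=> sp pz; pose P := p \Po ('X + 1).
have sXD1 : size ('X + 1 : {poly int}) = 2 by rewrite -[1]/(1%:P) size_XaddC.
have sP : size P = size p by rewrite size_comp_poly2.
have evX : zeval (z - 1) ('X + 1) = z.
  by rewrite rmorphD rmorph1 /= /zeval map_polyX hornerX subrK.
have irr := irreducible_XD1_pow2; set Q := _ + 1 in irr.
have Q0 : zeval (z - 1) Q = 0.
  by rewrite rmorphD rmorphXn rmorph1 /= evX zN addNr.
have P0 : zeval (z - 1) P = 0.
  by rewrite -pz /zeval map_comp_poly horner_comp -[X in _.[X]]/(zeval _ _) evX.
have [QP|] := boolP (Q %| P).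
  apply/eqP/negPn/negP => p0.
  have Pn0 : P != 0 by rewrite -size_poly_gt0 sP size_poly_gt0.
  have := leq_trans (dvdp_leq Pn0 QP) _ => /(_ N).
  by rewrite size_XD1_pow2 sP => /(_ sp); rewrite ltnn.
(* Over the integers, Bezout only gives a nonzero constant [c]; evaluation at z - 1 makes it 0. *)
rewrite -(irreducible_poly_coprime _ irr) => /Bezout_coprimepP[[u v] /=].
rewrite -size_poly_eq1 => /size_poly1P[c c0 E].
have := congr1 (zeval (z - 1)) E.
rewrite rmorphD !rmorphM /= Q0 P0 !mulr0 addr0 /zeval map_polyC hornerC.
by move/esym/eqP; rewrite intr_eq0 (negPf c0).
Qed.

Lemma monic_XnD1 (R : comNzRingType) M :
  (0 < M)%N -> ('X^M + 1 : {poly R}) \is monic.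
Proof. by move=> M0; rewrite -[1]opprK -polyCN monicXnsubC. Qed.

(** The divisor is monic, so the division stays integral. [y] and [M] are free because z^T is also
    used as a base. *)
Lemma zeval_rmodp M (y : C) (p : {poly int}) : (0 < M)%N -> y ^+ M = -1 ->
  exists q r : {poly int}, [/\ p = q * ('X^M + 1) + r,
    (size r <= M)%N & zeval y r = zeval y p].
Proof.
move=> M0 yM; have mon := @monic_XnD1 int M M0.
exists (Pdiv.Ring.rdivp p ('X^M + 1)), (Pdiv.Ring.rmodp p ('X^M + 1)).
have E := Pdiv.RingMonic.rdivp_eq mon p.
split=> //.
  rewrite -ltnS -[M.+1](_ : size ('X^M + 1 : {poly int}) = _).
    by rewrite Pdiv.Ring.ltn_rmodpN0 // monic_neq0.
  by rewrite -[1]opprK -polyCN size_XnsubC.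
rewrite [in RHS]E rmorphD rmorphM rmorphD rmorphXn rmorph1 /=.
by rewrite /zeval map_polyX hornerX yM addNr mulr0 add0r.
Qed.

Let N_gt0 : (0 < N)%N. Proof. by rewrite expn_gt0. Qed.

(** This makes the residue map Z[z] -> F_2 with z -> 1 well defined: X^N + 1 takes the value 2 at
    1. *)
Lemma zeval_parity (p q : {poly int}) :
  zeval z p = zeval z q -> (2 %| p.[1] - q.[1])%Z.
Proof.
move=> pq; have [d [r [E sr Er]]] := @zeval_rmodp N z (p - q) N_gt0 zN.
have r0 : r = 0 by apply: zeval_eq0 => //; rewrite Er rmorphB /= pq subrr.
rewrite -hornerN -hornerD E r0 addr0 !hornerE expr1n.
by rewrite dvdz_mull.
Qed.

(** * Divisibility in Z[z] and the prime 1 - z above 2 *)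

Definition zdvd (x y : C) := exists p, y = x * zeval z p.

Lemma zdvd_refl x : zdvd x x.
Proof. by exists 1; rewrite rmorph1 mulr1. Qed.

Lemma zdvd_trans y x w : zdvd x y -> zdvd y w -> zdvd x w.
Proof. by move=> [p ->] [q ->]; exists (p * q); rewrite rmorphM mulrA. Qed.

Lemma zdvdM x y x' y' : zdvd x y -> zdvd x' y' -> zdvd (x * x') (y * y').
Proof. by move=> [p ->] [q ->]; exists (p * q); rewrite rmorphM /=; ring. Qed.

Lemma zdvdX x y n : zdvd x y -> zdvd (x ^+ n) (y ^+ n).
Proof.
elim: n => [|n IH] xy; first by rewrite !expr0; apply: zdvd_refl.
by rewrite !exprS; apply: zdvdM (IH xy).
Qed.

Lemma zdvd_sub1X a b : zdvd (1 - z ^+ a) (1 - z ^+ a ^+ b).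
Proof.
exists (\sum_(i < b) 'X^(a * i)).
rewrite -[1 in LHS](expr1n C b) subrXX rmorph_sum; congr (_ * _).
by apply: eq_bigr => i _ /=; rewrite expr1n mul1r rmorphXn /= zevalX exprM.
Qed.

Lemma addr1_zX a : 1 + z ^+ a = 1 - z ^+ (a + N).
Proof. by rewrite exprD zN mulrN1 opprK. Qed.

Lemma zX_half j : (j <= m)%N -> z ^+ (2 ^ j) ^+ (2 ^ (m - j)) = -1.
Proof. by move=> jm; rewrite -exprM -expnD subnKC. Qed.

(** For w = z^(2^j), w^(2^(m-j)) = -1, so 1 + w = 1 - w^(1 + 2^(m-j)) is a multiple of 1 - w. *)
Lemma zdvd_1B_1D j : (j <= m)%N -> zdvd (1 - z ^+ (2 ^ j)) (1 + z ^+ (2 ^ j)).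
Proof.
move=> jm; have := zdvd_sub1X (2 ^ j) (1 + 2 ^ (m - j)).
by rewrite exprD zX_half // expr1 mulrN1 opprK.
Qed.

(** For w = z^(2^j) and v = -w, v^(1 + 2^(m-j)) = w, so 1 - v divides 1 - w. The strict bound makes
    2^(m-j) even, which removes the sign. *)
Lemma zdvd_1D_1B j : (j < m)%N -> zdvd (1 + z ^+ (2 ^ j)) (1 - z ^+ (2 ^ j)).
Proof.
move=> jm; have := zdvd_sub1X (2 ^ j + N) (1 + 2 ^ (m - j)).
rewrite -addr1_zX; congr (zdvd _ (1 - _)).
rewrite [z ^+ (_ + _)]exprD zN mulrN1 exprD expr1 exprNn zX_half 1?ltnW //.
by rewrite -signr_odd oddX subn_eq0 leqNgt jm mul1r mulrN1 opprK.
Qed.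

(** Induction on 1 - w^2 = (1 - w)(1 + w), whose two factors are associated. At j = m the right-hand
    side is 2. *)
Lemma zdvd_exp1B j : (j <= m)%N ->
  zdvd ((1 - z) ^+ (2 ^ j)) (1 - z ^+ (2 ^ j)).
Proof.
elim: j => [|j IH] jm; first by rewrite !expr1; apply: zdvd_refl.
rewrite expnSr [X in zdvd X]exprM expr2.
have -> : 1 - z ^+ (2 ^ j * 2) = (1 - z ^+ (2 ^ j)) * (1 + z ^+ (2 ^ j)).
  by rewrite exprM; ring.
apply: zdvdM; first exact/IH/ltnW.
exact: zdvd_trans (IH (ltnW jm)) (zdvd_1B_1D (ltnW jm)).
Qed.

Lemma zdvd_1Bexp j : (j <= m)%N ->
  zdvd (1 - z ^+ (2 ^ j)) ((1 - z) ^+ (2 ^ j)).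
Proof.
elim: j => [|j IH] jm; first by rewrite !expr1; apply: zdvd_refl.
rewrite expnSr [X in zdvd _ X]exprM expr2.
have -> : 1 - z ^+ (2 ^ j * 2) = (1 - z ^+ (2 ^ j)) * (1 + z ^+ (2 ^ j)).
  by rewrite exprM; ring.
apply: zdvdM; first exact/IH/ltnW.
exact: zdvd_trans (zdvd_1D_1B jm) (IH (ltnW jm)).
Qed.

Lemma zdvd_2 : zdvd ((1 - z) ^+ N) 2.
Proof.
by have := zdvd_exp1B (leqnn m); rewrite (zN : z ^+ (2 ^ m) = -1) opprK.
Qed.

Lemma norm_z : `|z| = 1.
Proof.
by apply/eqP; rewrite -(@pexpr_eq1 _ _ N) // -normrX zN normrN1.
Qed.

Lemma z_neq0 : z != 0.
Proof. by rewrite -normr_eq0 norm_z oner_eq0. Qed.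

Lemma conj_z : z^* = z ^+ (N.*2.-1).
Proof.
apply: (mulfI z_neq0); rewrite -normCK norm_z -exprS prednK ?double_gt0 //.
by rewrite -muln2 exprM zN expr1n sqrrN expr1n.
Qed.

(** Complex conjugation lifted to polynomials, z^(2N-1) being the inverse of [z]; the value at 1,
    hence the parity, is unchanged. *)
Definition zconj (p : {poly int}) : {poly int} := p \Po 'X^(N.*2.-1).

Lemma zeval_conj p : (zeval z p)^* = zeval z (zconj p).
Proof.
rewrite /zconj /zeval map_comp_poly horner_comp map_polyXn hornerXn -conj_z.
rewrite -horner_map /= -map_poly_comp; congr _.[_]; apply: eq_map_poly => i /=.
by rewrite rmorph_int.
Qed.

(** X - 1 divides p - p(1), and 1 - z divides 2, hence p(1). *)
Lemma zdvd_even p : (2 %| p.[1])%Z -> zdvd (1 - z) (zeval z p).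
Proof.
move=> /dvdzP[c Ec].
have /factor_theorem[q Eq] : root (p - p.[1]%:P) 1.
  by rewrite rootE !hornerE subrr.
have [w Ew] : zdvd (1 - z) 2.
  have := zdvd_2; apply: zdvd_trans.
  exists ((1 - 'X) ^+ N.-1).
  by rewrite rmorphXn rmorphB rmorph1 /= zevalX -exprS prednK.
exists (- q + c%:P * w).
have -> : p = q * ('X - 1) + c%:P * 2%:R.
  rewrite -[LHS](subrK p.[1]%:P) Eq Ec polyCM; congr (_ + _ * _).
  exact: (rmorph_nat (@polyC int) 2).
rewrite [LHS]rmorphD !rmorphM rmorph_nat Ew rmorphB rmorphD rmorphN rmorphM.
by rewrite /= zevalX rmorph1; ring.
Qed.

(** The norm has parity p(1)^2, so p(1) is even and one factor 1 - z leaves [p]; its conjugate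
    leaves the other factor, and induction applies. *)
Lemma zdvd_norm M p : zdvd ((1 - z) ^+ M.*2) (zeval z p * (zeval z p)^* ) ->
  zdvd ((1 - z) ^+ M) (zeval z p).
Proof.
elim: M p => [|M IH] p; first by move=> _; exists p; rewrite mul1r.
move=> [w Ew].
have [|q Eq] := @zdvd_even p.
  have : zeval z (p * zconj p) = zeval z ((1 - 'X) ^+ M.*2.+2 * w).
    rewrite rmorphM [RHS]rmorphM rmorphXn rmorphB rmorph1 /= zevalX.
    by rewrite -zeval_conj.
  move/zeval_parity; rewrite !hornerE subrr exprS !mul0r subr0 /zconj.
  rewrite horner_comp hornerXn expr1n -expr2.
  by rewrite !dvdzE abszX Euclid_dvdX // andbT.
have [|w' Ew'] := IH q; last first.
  by exists w'; rewrite Eq Ew' exprS; ring.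
(* The factor -X compensates the unit in (1 - z)(1 - conj z) = -z^(-1) (1 - z)^2. *)
exists (- 'X * w).
have z1 : 1 - z != 0.
  apply/eqP => /eqP; rewrite subr_eq0 => /eqP z1.
  have := zN; rewrite -z1 expr1n => /eqP.
  by rewrite -subr_eq0 opprK -mulr2n pnatr_eq0.
apply: (mulfI (mulf_neq0 z1 z1)).
have -> : (1 - z) * (1 - z) * (zeval z q * (zeval z q)^* ) =
    - z * (zeval z p * (zeval z p)^* ).
  rewrite Eq rmorphM rmorphB rmorph1.
  have E : z * z^* = 1 by rewrite -normCK norm_z expr1n.
  have -> : - z * ((1 - z) * zeval z q * ((1 - z^* ) * (zeval z q)^* )) =
    (z * z^* - z) * (1 - z) * (zeval z q * (zeval z q)^* ) by ring.
  by rewrite E.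
by rewrite Ew rmorphM rmorphN /= zevalX doubleS !exprS; ring.
Qed.

(** * Elements of modulus 1 in Z[z] *)

Lemma zeval_wide M (y : C) (p : {poly int}) : (size p <= M)%N ->
  zeval y p = \sum_(i < M) (p`_i)%:~R * y ^+ i.
Proof.
move=> sp; rewrite /zeval (@horner_coef_wide _ M).
  by apply: eq_bigr => i _; rewrite coef_map.
exact: leq_trans (size_poly _ _) sp.
Qed.

Lemma zeval_rev (p : {poly int}) : (size p <= N)%N ->
  zeval z (\poly_(i < N) p`_(N.-1 - i)) = (zeval z p)^* * z ^+ N.-1.
Proof.
move=> sp; rewrite (zeval_wide _ sp) (zeval_wide _ (size_poly _ _)).
rewrite rmorph_sum mulr_suml (reindex_inj rev_ord_inj) /=.
apply: eq_bigr => i _; rewrite coef_poly.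
have iN := ltn_ord i.
have -> : (N - i.+1 < N)%N by lia.
have -> : (N.-1 - (N - i.+1) = i)%N by lia.
rewrite rmorphM rmorph_int -mulrA; congr (_ * _).
have -> : (N.-1 = i + (N - i.+1))%N by lia.
rewrite exprD mulrA -normCKC normrX norm_z !expr1n mul1r.
by congr (_ ^+ _); lia.
Qed.

(* With p~ the reversal of p, the class of p p~ - X^(N-1) modulo X^N + 1 is 0;
   its coefficient of degree N - 1 is sum_i p_i^2 - 1, as deg (p p~) < 2N - 1. *)
Lemma sum_sqr_coef (p : {poly int}) : (size p <= N)%N ->
  `|zeval z p| = 1 -> \sum_(i < N) p`_i ^+ 2 = 1.
Proof.
move=> sp p1; set rv := \poly_(i < N) p`_(N.-1 - i).
have srv : (size rv <= N)%N by exact: size_poly.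
have [d [r [E sr Er]]] := @zeval_rmodp N z (p * rv - 'X^(N.-1)) N_gt0 zN.
have r0 : r = 0.
  apply: zeval_eq0 => //; rewrite Er rmorphB rmorphM rmorphXn /= zevalX.
  by rewrite zeval_rev // mulrA -normCK p1 expr1n mul1r subrr.
(* Hence neither [d] nor [d * 'X^N] has a term of degree N - 1. *)
have sd : (size d <= N.-1)%N.
  have [->|d0] := eqVneq d 0; first by rewrite size_poly0.
  have : (size (p * rv - 'X^(N.-1))%R <= (N + N).-1)%N.
    rewrite (leq_trans (size_polyD _ _)) // geq_max size_polyN size_polyXn.
    apply/andP; split; last by lia.
    apply: leq_trans (size_polyMleq _ _) _.
    by rewrite -!subn1 leq_sub2r ?leq_add.
  rewrite E r0 addr0 size_Mmonic ?monic_XnD1 //.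
  by rewrite -[1]opprK -polyCN size_XnsubC //; lia.
have := congr1 (fun f : {poly int} => f`_N.-1) E.
rewrite r0 addr0 mulrDr mulr1 coefB coefXn eqxx coefD coefMXn.
have -> : (N.-1 < N)%N by lia.
rewrite [d`__]nth_default // addr0 => /eqP; rewrite subr_eq0 => /eqP s1.
rewrite -[RHS]/(true%:R) -s1.
rewrite coefM prednK //; apply: eq_bigr => i _.
have iN := ltn_ord i.
rewrite coef_poly.
have -> : (N.-1 - i < N)%N by lia.
by have -> : (N.-1 - (N.-1 - i) = i)%N by lia.
Qed.

(** Integers whose squares add up to 1 are all 0 except for one, which is 1 or -1; the sign is
    absorbed by z^N = -1. *)
Lemma zeval_unit (p : {poly int}) :
  `|zeval z p| = 1 -> exists j, zeval z p = z ^+ j.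
Proof.
have [d [r [_ sr <-]]] := @zeval_rmodp N z p N_gt0 zN.
move=> /(sum_sqr_coef sr) s1.
have /existsP[i ri] : [exists i : 'I_N, r`_i != 0].
  apply: contraPT s1 => /existsPn r0; rewrite big1 // => i _.
  by move: (r0 i); rewrite negbK => /eqP ->; rewrite expr0n.
move: s1; rewrite (bigD1 i) //=; set s := \sum_(_ | _) _ => s1.
have s_ge0 : 0 <= s by apply: sumr_ge0 => j _; exact: sqr_ge0.
have ri_gt0 : 0 < r`_i ^+ 2 by rewrite lt_def sqrf_eq0 ri sqr_ge0.
have s0 : s = 0.
  by move: s1 s_ge0 ri_gt0; move: (r`_i ^+ 2) s => /= a b; lia.
have r0 j : j != i -> r`_j = 0.
  move=> ji; have := psumr_eq0P (fun j _ => sqr_ge0 r`_(nat_of_ord j)) s0 ji.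
  by move/eqP; rewrite sqrf_eq0 => /eqP.
have /eqP : r`_i ^+ 2 = 1 by rewrite -s1 s0 addr0.
rewrite (zeval_wide _ sr) (bigD1 i) //= big1 ?addr0; last first.
  by move=> j /r0 ->; rewrite mul0r.
rewrite sqrf_eq1 => /orP[] /eqP ->; first by exists i; rewrite mul1r.
by exists (N + i)%N; rewrite exprD zN.
Qed.

(** * Independence over Z[z^T] and elements of norm 2^n *)

(** Once each [Q b] is reduced below degree M, the relation is a polynomial in [z] of degree below
    MT = N, so it is zero coefficientwise. *)
Lemma zeval_basis t (M := (2 ^ (m - t))%N) (T := (2 ^ t)%N)
    (Q : 'I_T -> {poly int}) : (t <= m)%N ->
  \sum_(b < T) z ^+ b * zeval (z ^+ T) (Q b) = 0 ->
  forall b, zeval (z ^+ T) (Q b) = 0.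
Proof.
move=> tm E.
have TM : (M * T = N)%N by rewrite -expnD subnK.
have T0 : (0 < T)%N by rewrite expn_gt0.
have M0 : (0 < M)%N by rewrite expn_gt0.
have yM : (z ^+ T) ^+ M = -1 by rewrite -exprM mulnC TM.
have /fin_all_exists[r Er] (b : 'I_T) : exists r : {poly int},
    (size r <= M)%N /\ zeval (z ^+ T) r = zeval (z ^+ T) (Q b).
  by have [d [r [_ sr Er]]] := @zeval_rmodp M (z ^+ T) (Q b) M0 yM; exists r.
pose P := \sum_(b < T) 'X^b * (r b \Po 'X^T).
have P0 : P = 0.
  apply: zeval_eq0.
    apply: (leq_trans (size_sum _ _ _)); apply/bigmax_leqP => b _.
    apply: (leq_trans (size_polyMleq _ _)); rewrite size_polyXn /=.
    have := size_comp_poly_leq (r b) 'X^T; rewrite size_polyXn /=.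
    have [sr _] := Er b; have bT := ltn_ord b.
    have : ((size (r b)).-1 * T <= M.-1 * T)%N by rewrite leq_mul2r; lia.
    have -> : (M.-1 * T = N - T)%N by rewrite -subn1 mulnBl mul1n TM.
    have : (T <= N)%N by rewrite -TM leq_pmull.
    move=> TN vN uv; apply: leq_trans (leq_add (leqnn b) uv) _.
    by rewrite addnS -addSn -(subnKC TN) leq_add.
  rewrite -[RHS]E rmorph_sum; apply: eq_bigr => b _; rewrite rmorphM /=.
  rewrite zevalXn -(Er b).2; congr (_ * _).
  by rewrite /zeval map_comp_poly horner_comp map_polyXn hornerXn.
move=> b; rewrite -(Er b).2; have -> : r b = 0; last by rewrite rmorph0.
apply/polyP => l; rewrite coef0.
(* As b < T, the exponent b + lT determines [b] and [l]: only the summand [b] contributes. *)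
have := congr1 (fun f : {poly int} => f`_(b + l * T)) P0.
rewrite coef0 coef_sum (bigD1 b) //= big1 ?addr0 => [|c cb].
  rewrite coefXnM ltnNge leq_addr /= addKn coef_comp_poly_Xn // dvdn_mull //.
  by rewrite mulnK.
rewrite coefXnM; case: ltnP => // cl; rewrite coef_comp_poly_Xn //.
case: ifP => // /dvdnP[a Ea]; case/eqP: cb; apply/val_inj => /=.
have : (b + l * T = c + a * T)%N by lia.
move/(congr1 (modn^~ T)); rewrite ![(_ + _ * T)%N]addnC !modnMDl.
by rewrite !modn_small.
Qed.

(* A primitive fourth root of unity when 0 < m. *)
Let i4 := z ^+ (2 ^ m.-1).

Lemma norm_1Bi4 : (0 < m)%N -> `|1 - i4| ^+ 2 = 2.
Proof.
move=> m0; have i2 : i4 ^+ 2 = -1 by rewrite -exprM -expnSr prednK.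
have ic : i4 * i4^* = 1 by rewrite -normCK normrX norm_z !expr1n.
have i0 : i4 != 0 by rewrite expf_neq0 ?z_neq0.
have Ec : i4^* = - i4.
  by apply: (mulfI i0); rewrite ic mulrN -expr2 i2 opprK.
rewrite normCK rmorphB rmorph1 /= Ec opprK.
have -> : (1 - i4) * (1 + i4) = 1 - i4 ^+ 2 by ring.
by rewrite i2 opprK.
Qed.

(** (1 - z)^(Nn) divides 2^n, so (1 - z)^(Nn/2) divides the value of [p], and with it (1 - i4)^n.
    The cofactor has modulus 1 because 1 - i4 has squared modulus 2. *)
Lemma zeval_norm_pow2 n (p : {poly int}) : (0 < m)%N ->
  `|zeval z p| ^+ 2 = 2 ^+ n -> exists j, zeval z p = (1 - i4) ^+ n * z ^+ j.
Proof.
move=> m0 p2; pose h := (2 ^ m.-1)%N.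
have hN : h.*2 = N by rewrite -muln2 -expnSr prednK.
have [q Eq] : zdvd ((1 - i4) ^+ n) (zeval z p).
  apply: (@zdvd_trans ((1 - z) ^+ (h * n))).
    by rewrite exprM; apply/zdvdX/zdvd_1Bexp/leq_pred.
  apply: zdvd_norm; rewrite -normCK p2 doubleMl hN exprM.
  exact/zdvdX/zdvd_2.
rewrite Eq; have [|j ->] := @zeval_unit q; last by exists j.
have : `|zeval z q| ^+ 2 = 1.
  have n0 : (2 : C) ^+ n != 0 by rewrite expf_neq0 // pnatr_eq0.
  apply: (mulfI n0); rewrite mulr1 -[RHS]p2 Eq normrM exprMn normrX exprAC.
  by rewrite norm_1Bi4.
by move/eqP; rewrite pexpr_eq1 // => /eqP.
Qed.

(** * Splitting the sum by the value of [G] *)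

Section Components.

Variables (X : finType) (t : nat) (G H e : X -> nat).
Let T := (2 ^ t)%N.
Hypothesis GT : forall x, (G x < T)%N.

Lemma norm_components (q : {poly int}) j : (t <= m)%N ->
  \sum_x z ^+ (G x + T * H x) * (-1) ^+ e x = zeval (z ^+ T) q * z ^+ j ->
  forall y : C, `|y| = 1 ->
  `|\sum_x y ^+ G x * z ^+ (T * H x) * (-1) ^+ e x| =
  `|\sum_x z ^+ (G x + T * H x) * (-1) ^+ e x|.
Proof.
move=> tm E.
have T0 : (0 < T)%N by rewrite expn_gt0.
pose g x := Ordinal (GT x).
pose S b := \sum_(x | g x == b) 'X^(H x) * (-1) ^+ e x : {poly int}.
have SE (y : C) : \sum_x y ^+ G x * z ^+ (T * H x) * (-1) ^+ e x =
    \sum_(b < T) y ^+ b * zeval (z ^+ T) (S b).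
  rewrite (partition_big g xpredT) //=; apply: eq_bigr => b _.
  rewrite rmorph_sum mulr_sumr; apply: eq_bigr => x /eqP <- /=.
  by rewrite rmorphM !rmorphXn rmorphN1 /= zevalX mulrA exprM.
have SEz : \sum_x z ^+ (G x + T * H x) * (-1) ^+ e x =
    \sum_(b < T) z ^+ b * zeval (z ^+ T) (S b).
  by rewrite -SE; apply: eq_bigr => x _; rewrite exprD.
(* z^j = z^b0 (z^T)^(j / T), so the right-hand side of [E] only has a component at [b0]. *)
pose b0 := Ordinal (ltn_pmod j T0).
have S0 b : b != b0 -> zeval (z ^+ T) (S b) = 0.
  move=> bb0; pose Q b := S b - (if b == b0 then q * 'X^(j %/ T) else 0).
  have := @zeval_basis t Q tm; rewrite -/T => /(_ _ b).
  rewrite /Q (negPf bb0) subr0.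
  apply; under eq_bigr do rewrite rmorphB mulrBr.
  rewrite big_split /= -SEz E sumrN (bigD1 b0) //= eqxx.
  rewrite big1 ?addr0 => [|c /negPf ->]; last by rewrite rmorph0 mulr0.
  rewrite rmorphM /= zevalXn -exprM.
  rewrite [X in _ * z ^+ X](divn_eq j T) exprD mulnC.
  by ring.
have norm_y (y : C) : `|y| = 1 ->
    `|\sum_(b < T) y ^+ b * zeval (z ^+ T) (S b)| = `|zeval (z ^+ T) (S b0)|.
  move=> y1; rewrite (bigD1 b0) //= big1 ?addr0 => [|b /S0 ->]; last first.
    by rewrite mulr0.
  by rewrite normrM normrX y1 expr1n mul1r.
by move=> y y1; rewrite SE SEz !norm_y ?norm_z.
Qed.

Lemma norm_components_pow2 n : (0 < m)%N -> (t <= m)%N ->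
  ~~ odd n \/ (t < m)%N ->
  `|\sum_x z ^+ (G x + T * H x) * (-1) ^+ e x| ^+ 2 = 2 ^+ n ->
  forall y : C, `|y| = 1 ->
  `|\sum_x y ^+ G x * z ^+ (T * H x) * (-1) ^+ e x| =
  `|\sum_x z ^+ (G x + T * H x) * (-1) ^+ e x|.
Proof.
move=> m0 tm even_or E.
pose p := \sum_x 'X^(G x + T * H x) * (-1) ^+ e x : {poly int}.
have pE : zeval z p = \sum_x z ^+ (G x + T * H x) * (-1) ^+ e x.
  rewrite rmorph_sum; apply: eq_bigr => x _ /=.
  by rewrite rmorphM !rmorphXn rmorphN1 /= zevalX.
have [j Ej] : exists j, zeval z p = (1 - i4) ^+ n * z ^+ j.
  by apply: zeval_norm_pow2 => //; rewrite pE.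
case: even_or => [n_even|t_lt].
  (* (1 - i4)^2 = -2 i4, so (1 - i4)^n is an integer times a power of [z]. *)
  apply: (@norm_components ((-2) ^+ n./2) (2 ^ m.-1 * n./2 + j)) => //.
  rewrite -pE Ej -[n in LHS]odd_double_half (negPf n_even) add0n.
  have i2 : i4 ^+ 2 = -1 by rewrite -exprM -expnSr prednK.
  rewrite -mul2n exprM.
  have -> : (1 - i4) ^+ 2 = (-2) * i4.
    by rewrite -[RHS]addr0 -(subrr (-1)) -{1}i2; ring.
  rewrite rmorphXn rmorphN rmorph_nat exprD exprM exprMn -/i4.
  by ring.
(* When t < m, i4 is the power of z^T with exponent 2^(m-1-t), so 1 - i4 lies in Z[z^T]. *)
apply: (@norm_components ((1 - 'X^(2 ^ (m.-1 - t))) ^+ n) j) => //.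
rewrite -pE Ej rmorphXn; congr (_ ^+ _ * _).
rewrite rmorphB rmorph1 /= zevalXn -exprM -expnD subnKC //.
by rewrite -ltnS prednK.
Qed.

End Components.

End Pow2.

Local Open Scope complex_scope.

(** * The roots of unity [zeta] and the conclusion *)

Lemma expr_cos_sin (R : realType) (a : R) n :
  (cos a +i* sin a) ^+ n = cos (a *+ n) +i* sin (a *+ n) :> R[i].
Proof.
elim: n => [|n IH]; first by rewrite expr0 mulr0n cos0 sin0.
rewrite exprSr IH mulrSr cosD sinD; simpc.
by congr (_ +i* _); ring.
Qed.

Lemma zeta_expr_pow2 (R : realType) r s :
  (s <= r)%N -> zeta R r ^+ (2 ^ s) = zeta R (r - s).
Proof.
move=> sr; rewrite /zeta expr_cos_sin.
suff -> : 2 * pi / 2 ^+ r *+ 2 ^ s = 2 * pi / 2 ^+ (r - s) :> R by [].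
rewrite -mulr_natr natrX -{1}(subnK sr) exprD.
by field; rewrite !expf_neq0 // pnatr_eq0.
Qed.

Lemma zeta1 (R : realType) : zeta R 1 = -1.
Proof.
rewrite /zeta expr1 mulrAC divff ?pnatr_eq0 // mul1r cospi sinpi.
by rewrite -[RHS]/((-1) +i* (-0)) oppr0.
Qed.

Lemma zeta_expr_half (R : realType) r :
  (0 < r)%N -> zeta R r ^+ (2 ^ r.-1) = -1.
Proof.
by move=> r0; rewrite zeta_expr_pow2 ?leq_pred // -subn1 subKn // zeta1.
Qed.

Lemma zeta_expr_order (R : realType) r : zeta R r ^+ (2 ^ r) = 1.
Proof.
case: r => [|r]; last by rewrite expnSr exprM zeta_expr_half // sqrrN expr1n.
by rewrite expr1 /zeta expr0 divr1 mulr_natl cos2pi sin2pi.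
Qed.

Lemma sqr_powR_half (R : realType) n :
  (((2 : R) `^ (n%:R / 2))%:C : R[i]) ^+ 2 = 2 ^+ n.
Proof.
rewrite -rmorphXn -powR_mulrn ?powR_ge0 // -powRrM divfK ?pnatr_eq0 //.
by rewrite powR_mulrn // rmorphXn rmorph_nat.
Qed.

Theorem proposition4p5 (R : realType) (n t k : nat) (L : finFieldType)
    (cardL : #|L| = (2 ^ n)%N) (t_ge1 : (1 <= t)%N) (k_ge2t : (2 * t <= k)%N)
    (a : nat -> L -> 'F_2)
    (f : L -> 'Z_(2 ^ k)) (g : L -> 'Z_(2 ^ t)) (h : L -> 'Z_(2 ^ (k - t)))
    (f_bits : forall x : L,
       f x = \sum_(1 <= i < k.+1) 2 ^+ (i - 1) * (a i x : nat)%:R)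
    (g_bits : forall x : L,
       g x = \sum_(1 <= i < t.+1) 2 ^+ (i - 1) * (a i x : nat)%:R)
    (h_bits : forall x : L,
       h x = \sum_(t.+1 <= i < k.+1) 2 ^+ (i - t.+1) * (a i x : nat)%:R)
    (f_gh : forall x : L,
       f x = (g x : nat)%:R + 2 ^+ t * (h x : nat)%:R)
    (f_hyperbent : g_hyperbent R n k f)
    (n_even_or_k_ge3 : ~~ odd n \/ (3 <= k)%N) :
  g_hyperbent R n (k - t) h /\
  g_hyperbent R n (k - t)
    (fun x : L => h x + 2 ^+ (k - 2 * t) * (g x : nat)%:R).
Proof.
have one_lt_exp p : (0 < p)%N -> (1 < 2 ^ p)%N.
  by move=> p0; rewrite -{1}(expn0 2) ltn_exp2l.
have ltZ (p : nat) (y : 'Z_(2 ^ p)) : (0 < p)%N -> (y < 2 ^ p)%N.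
  by move=> p0; rewrite -{2}(@Zp_cast (2 ^ p)) ?ltn_ord ?one_lt_exp.
have k0 : (0 < k)%N by lia.
have kt0 : (0 < k - t)%N by lia.
pose z := zeta R k.
have zN : z ^+ (2 ^ k.-1) = -1 by exact: zeta_expr_half.
have zT : zeta R (k - t) = z ^+ (2 ^ t) by rewrite zeta_expr_pow2 //; lia.
(* No reduction modulo 2^k occurs, the representatives being below 2^t and 2^(k-t). *)
have f_nat x : f x = (g x + 2 ^ t * h x)%N :> nat.
  rewrite f_gh -natrX -natrM -natrD val_Zp_nat ?one_lt_exp // modn_small //.
  have gx := ltZ _ (g x) t_ge1; have hx := ltZ _ (h x) kt0.
  have -> : (2 ^ k = 2 ^ t * 2 ^ (k - t))%N by rewrite -expnD subnKC //; lia.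
  by nia.
have z_norm : `|z| = 1 by exact: norm_z zN.
have sum_norm u i (y : R[i]) : (1 <= i)%N -> coprime i (2 ^ n - 1) -> `|y| = 1 ->
    `|\sum_x y ^+ g x * z ^+ (2 ^ t * h x) * (-1) ^+ abs_trace n (u * x ^+ i)|
    = ((2 : R) `^ (n%:R / 2))%:C.
  move=> i1 ci y1; have := f_hyperbent u i i1 ci.
  under eq_bigr do rewrite f_nat.
  move=> E; rewrite -E; apply: (norm_components_pow2 zN _ (n := n)) => //.
  - by move=> x; exact: ltZ.
  - by lia.
  - by lia.
  (* Here m = k - 1, and t < k - 1 follows from 2t <= k and k >= 3. *)
  - by case: n_even_or_k_ge3 => [|k3]; [left|right; lia].
  - by rewrite E sqr_powR_half.
split=> u i i1 ci.
  rewrite -(sum_norm u i 1) ?normr1 //; congr `|_|; apply: eq_bigr => x _.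
  by rewrite expr1n mul1r zT exprM.
rewrite -(sum_norm u i (z ^+ (2 ^ (k - t)))) ?normrX ?z_norm ?expr1n //.
congr `|_|; apply: eq_bigr => x _; congr (_ * _).
rewrite -[h x]natr_Zp -natrX -natrM -natrD val_Zp_nat ?one_lt_exp //.
(* Reduction modulo 2^(k-t) does not change the power of [zeta R (k - t)]. *)
rewrite expr_mod ?zeta_expr_order // zT -!exprM -exprD; congr (_ ^+ _).
have E2 : (2 ^ (k - t) = 2 ^ t * 2 ^ (k - 2 * t))%N.
  by rewrite -expnD; congr (_ ^ _)%N; lia.
by rewrite natr_Zp mulnDr mulnA -E2 addnC.
Qed.
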